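(* For every even integer $k \ge 0$, there exists a graph $G$ such that $\mathrm{lcr}^\circ(G) = k$ and $\mathrm{tw}(G) = k+2$, where $\mathrm{tw}$ denotes treewidth.
   Context: A convex drawing of a finite simple graph $G$ places the vertices at distinct points of a circle and draws every edge as a straight-line segment; it is outer $k$-planar if every edge crosses at most $k$ other edges. The convex local crossing number $\mathrm{lcr}^\circ(G)$ is the smallest $k$ such that $G$ admits an outer $k$-planar drawing. *)

(* Defs.v *)
From mathcomp Require Import all_boot all_order all_algebra.
From mathcomp Require Import boolp reals ring.

Set Implicit Arguments.
Unset Strict Implicit.
Unset Printing Implicit Defensive.

Import Order.TTheory GRing.Theory Num.Theory.
Local Open Scope ring_scope.

Record sgraph := SGraph {
  vertex :> finType;
  adj : rel vertex;
  adj_sym : symmetric adj;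
  adj_irrefl : irreflexive adj }.

Definition edges (G : sgraph) : {set {set G}} :=
  [set [set u; v] | u in G, v in G & adj u v].

Section ConvexDrawing.
Variables (R : realType) (G : sgraph).

Definition on_circle (c : 'rV[R]_2) (r : R) (z : 'rV[R]_2) : Prop :=
  (z 0 0 - c 0 0) ^+ 2 + (z 0 1 - c 0 1) ^+ 2 = r ^+ 2.

(* A straight-line drawing is determined by the positions of the vertices. *)
Definition convex_drawing (p : G -> 'rV[R]_2) : Prop :=
  injective p /\ exists c r, 0 < r /\ forall v, on_circle c r (p v).

Definition edge_interior (p : G -> 'rV[R]_2) (f : {set G}) (z : 'rV[R]_2) :=
  exists u v : G, f = [set u; v] /\ u != v /\
    exists t : R, 0 < t < 1 /\ z = (1 - t) *: p u + t *: p v.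

(* Endpoints are excluded, so edges sharing a vertex do not cross there. *)
Definition crosses (p : G -> 'rV[R]_2) (f g : {set G}) : Prop :=
  f != g /\ exists z, edge_interior p f z /\ edge_interior p g z.

Definition outer_kplanar_drawing (k : nat) (p : G -> 'rV[R]_2) : Prop :=
  convex_drawing p /\
  forall f, f \in edges G -> (#|[set g in edges G | `[< crosses p f g >]]| <= k)%N.

Definition outer_kplanar (k : nat) : Prop :=
  exists p, outer_kplanar_drawing k p.

Lemma convex_drawing_exists : exists p, convex_drawing p.
Proof.
pose s (v : G) : R := (enum_rank v)%:R.
pose p (v : G) : 'rV[R]_2 := \row_j
  (if j == 0 then (1 - s v ^+ 2) / (1 + s v ^+ 2) else s v *+ 2 / (1 + s v ^+ 2)).
have s1 v : 1 + s v ^+ 2 != 0 by rewrite gt_eqF// ltr_pwDl// sqr_ge0.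
exists p; split=> [u v /rowP puv|].
  have := puv 0; have := puv 1; rewrite !mxE /= => e1 e0.
  have h v' : 1 + (1 - s v' ^+ 2) / (1 + s v' ^+ 2) = 2 / (1 + s v' ^+ 2).
    by rewrite -[X in X + _](divff (s1 v')) -mulrDl; congr (_ / _); ring.
  have sE v' : s v' = (s v' *+ 2 / (1 + s v' ^+ 2)) /
                      (1 + (1 - s v' ^+ 2) / (1 + s v' ^+ 2)).
    by rewrite h invf_div mulrA mulfVK // -[s v' *+ 2]mulr_natr mulfK // pnatr_eq0.
  have : s u = s v by rewrite sE e1 e0 -sE.
  by move/eqP; rewrite eqr_nat => /eqP/val_inj/enum_rank_inj.
exists 0, 1; split=> // v; rewrite /on_circle !mxE /= !subr0.
by rewrite !expr_div_n -mulrDl; apply: (canLR (mulfK _)); rewrite ?expf_neq0//; ring.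
Qed.

Lemma outer_kplanar_exists : exists k, `[< outer_kplanar k >].
Proof.
have [p hp] := convex_drawing_exists.
exists #|edges G|; apply/asboolP; exists p; split=> // f _.
by apply: subset_leq_card; apply/subsetP => g; rewrite inE => /andP[].
Qed.

Definition lcr_convex : nat := ex_minn outer_kplanar_exists.

End ConvexDrawing.

Definition is_tree (T : sgraph) : Prop :=
  (0 < #|T|)%N /\ (forall s t : T, connect (@adj T) s t) /\
  (forall c : seq T, ucycle (@adj T) c -> (size c < 3)%N).

Section Treewidth.
Variable G : sgraph.

Definition tree_decomposition (T : sgraph) (B : T -> {set G}) : Prop :=
  [/\ is_tree T,
      forall v : G, exists t, v \in B t,
      forall u v : G, adj u v -> exists t, (u \in B t) && (v \in B t)
    & forall (v : G) (s t : T), v \in B s -> v \in B t ->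
        connect [rel a b in [set a | v \in B a] | adj a b] s t].

(* Truncated: the graph without vertices gets width 0 instead of -1. *)
Definition width (T : sgraph) (B : T -> {set G}) : nat :=
  (\max_(t : T) #|B t|).-1.

Definition has_width (w : nat) : Prop :=
  exists (T : sgraph) (B : T -> {set G}), tree_decomposition B /\ width B = w.

Lemma has_width_exists : exists w, `[< has_width w >].
Proof.
pose T := @SGraph unit (fun _ _ => false) (fun _ _ => erefl) (fun _ => erefl).
pose B (_ : T) : {set G} := [set: G].
exists (width B); apply/asboolP; exists T, B; split=> //; split.
- split; first by rewrite card_unit.
  split=> [[] []|]; first exact: connect0.
  by case=> [|x [|y c]] //=; rewrite /ucycle /= andbF.
- by move=> v; exists tt; rewrite inE.
- by move=> u v _; exists tt; rewrite !inE.
- by move=> v [] [] _ _; exact: connect0.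
Qed.

Definition treewidth : nat := ex_minn has_width_exists.

End Treewidth.

(* Main.v *)
Require Import Defs.
From mathcomp Require Import all_boot all_order all_algebra.
From mathcomp Require Import boolp reals.
From mathcomp Require Import ring lra zify.

(* Write k = 2q and n = q + 1.  The graph is carved out of the disjoint union
   of the cylinder C_m x P_n, with m odd and large, and of K_{2,2k+2}.

   Drawing the cylinder column after column on the circle, an edge between
   cyclically consecutive columns is crossed by at most 2(n - 1) = k edges and
   an edge inside a column by none.  In any convex drawing of K_{2,2k+2}, some
   side of the line through the hubs a and b contains k + 1 of the common
   neighbours; if w is the one closest to b among them, then the edge aw crosses
   the edges joining b to the k others.  So the union has local crossing number
   k, and so has each of its subgraphs containing K_{2,2k+2}.

   The cylinder has treewidth at least 2n = k + 2: with m = 2h + 1, the arcs of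
   length h of one row, together with the unions of a row minus one vertex and
   of at least h + 2 columns, form a bramble that no 2n vertices can hit.
   Isolating the vertices of the cylinder one after the other decreases the
   treewidth by at most one at each step, down to tw(K_{2,2k+2}) <= 2, hence it
   takes the value k + 2 on the way. *)

Set Implicit Arguments.
Unset Strict Implicit.
Unset Printing Implicit Defensive.

(** * Subtrees of a tree and brambles *)

Definition within (T : finType) (e : rel T) (A : {set T}) : rel T :=
  [rel x y in A | e x y].

Definition connected_in (T : finType) (e : rel T) (A : {set T}) : Prop :=
  {in A &, forall x y, connect (within e A) x y}.

Section Connectivity.
Variables (T : finType) (e : rel T).
Hypothesis e_sym : symmetric e.

Lemma within_sym (A : {set T}) : symmetric (within e A).
Proof. by move=> x y; rewrite /within /= e_sym (andbC (x \in A)). Qed.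

Lemma connect_within_sym (A : {set T}) : connect_sym (within e A).
Proof. exact/sym_connect_sym/within_sym. Qed.

Lemma connect_within_sub (A B : {set T}) x y :
  A \subset B -> connect (within e A) x y -> connect (within e B) x y.
Proof.
move=> /subsetP AB; apply: connect_sub => a b /andP[/andP[aA bA] ab].
by apply: connect1; rewrite /within /= !AB.
Qed.

Lemma connected_in1 x : connected_in e [set x].
Proof. by move=> y z; rewrite !inE => /eqP-> /eqP->. Qed.

Lemma connected_inU (A B : {set T}) x y :
    connected_in e A -> connected_in e B ->
    x \in A -> y \in B -> (x == y) || e x y ->
  connected_in e (A :|: B).
Proof.
move=> cA cB xA yB xy.
have xUy : connect (within e (A :|: B)) x y.
  case/orP: xy => [/eqP-> //|exy].
  by apply: connect1; rewrite /within /= !inE xA yB orbT.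
have toA z : z \in A -> connect (within e (A :|: B)) z x.
  by move=> zA; apply: connect_within_sub (cA _ _ zA xA); exact: subsetUl.
have toB z : z \in B -> connect (within e (A :|: B)) z x.
  move=> zB; apply: (@connect_trans _ _ y).
    by apply: connect_within_sub (cB _ _ zB yB); exact: subsetUr.
  by rewrite connect_within_sym.
have toU z : z \in A :|: B -> connect (within e (A :|: B)) z x.
  by rewrite inE => /orP[/toA|/toB].
by move=> z t /toU zx /toU tx; apply: connect_trans zx _; rewrite connect_within_sym.
Qed.

(** A path made simple never returns to [x] after its first step. *)
Lemma connect_first_step (r : rel T) x y :
  connect r x y -> x != y ->
  exists2 z, r x z & connect (within r [set~ x]) z y.
Proof.
case/connectP=> p rp ->; case/shortenP: rp => -[|z p'] /=; rewrite ?eqxx //.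
case/andP=> xz zp /andP[xp _] _ _; exists z => //; apply/connectP; exists p' => //.
elim: p' z xp zp {xz} => //= w p' IH z; rewrite !inE !negb_or => /and3P[xz xw xp].
case/andP=> zw wp; rewrite /within /= !inE zw eq_sym xz eq_sym xw /=.
by apply: IH; rewrite // inE negb_or xw.
Qed.

End Connectivity.

Section Trees.
Variables (T : sgraph).
Hypothesis treeT : is_tree T.
Let e := @adj T.
Let e_sym : symmetric e := @adj_sym T.

(** Otherwise a simple path from [y] to [z] avoiding [x], closed up through [x], would be a cycle
    with at least three vertices. *)
Lemma tree_neighbours_split (x y z : T) :
  e x y -> e x z -> connect (within e [set~ x]) y z -> y = z.
Proof.
move=> xy xz /connectP[p yp zE]; case: treeT => _ [_ acyc].
move: xz; rewrite {}zE; case/shortenP: yp => p' yp' up' _ xl.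
have sub : path e y p' && all [pred w | w != x] p'.
  elim: p' y yp' {up' xl xy} => //= w p' IH y /andP[/andP[/andP[_ wx] yw] wp].
  by have /andP[-> ->] := IH _ wp; rewrite yw -in_set1 -in_setC wx.
case/andP: sub => ep' /allP xp'.
case: p' => // w p' in yp' up' xl ep' xp' *.
suff /acyc : ucycle e [:: x, y, w & p'] by [].
rewrite /ucycle /cycle rcons_path; apply/andP; split.
  by rewrite [path _ _ (y :: _)]/= xy [X in X && _](_ : _ = path e y (w :: p')) // ep' e_sym.
rewrite -[uniq _]/((x \notin y :: w :: p') && uniq (y :: w :: p')) up' andbT inE negb_or.
apply/andP; split; first by apply/eqP=> xE; move: xy; rewrite xE /e adj_irrefl.
by apply/negP=> /xp' /=; rewrite eqxx.
Qed.

(* If no node is common, each node t misses some subtree S, which lies in one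
   component of T - t; the pair with the smallest such component moves one step
   towards S to a still smaller one, or else closes a cycle. *)
Lemma tree_helly (F : {set {set T}}) :
    {in F, forall S, connected_in e S} ->
    {in F &, forall S S', exists x, x \in S :&: S'} ->
  exists t, {in F, forall S : {set T}, t \in S}.
Proof.
move=> cF iF; apply: contrapT => noc.
have out t : exists2 S, S \in F & t \notin S.
  apply: contrapT => h; apply: noc; exists t => S SF.
  by apply: contrapT => /negP tS; apply: h; exists S.
have key n t (S : {set T}) x : S \in F -> t \notin S -> x \in S ->
    (#|[set y | connect (within e [set~ t]) x y]| < n)%N -> False.
  elim: n t S x => // n IH t S x SF tS xS; rewrite ltnS => lec.
  have nt y : y \in S -> y != t by apply: contraTneq => ->.
  case: treeT => _ [/(_ t x) /connect_first_step step _].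
  have [|s ts sx] := step; first by rewrite eq_sym nt.
  have [S' S'F sS'] := out s.
  have [x'] := iF _ _ SF S'F; rewrite inE => /andP[x'S x'S'].
  have sub : S \subset [set~ t].
    by apply/subsetP => y /nt; rewrite !inE.
  have xx' : connect (within e [set~ t]) x x'.
    exact: connect_within_sub (cF _ SF _ _ xS x'S).
  have sx' := connect_trans sx xx'.
  have [tx'|ntx'] := boolP (connect (within e [set~ s]) t x').
    have [|y ty yx'] := connect_first_step tx'; first by rewrite eq_sym nt.
    case/andP: ty => /andP[_ ys] ty.
    have yx : connect (within e [set~ t]) y x'.
      apply: connect_sub yx' => a b /andP[abt /andP[_ ab]].
      by apply: connect1; rewrite /within /= abt.
    move: ys; rewrite !inE (@tree_neighbours_split t y s) ?eqxx //.
    by apply: connect_trans yx _; rewrite connect_within_sym.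
  (* The component of [x'] in [T - s] misses [t], hence lies in that of [x] in [T - t]; it also
     misses [s], which belongs to the latter. *)
  apply: (IH s S' x') => //; apply: leq_trans lec; apply: proper_card.
  apply/properP; split.
    apply/subsetP => z; rewrite !inE => x'z; apply: connect_trans xx' _.
    case/connectP: x'z => p x'p ->; apply/connectP; exists p => //.
    elim: p x' x'p ntx' {x'S x'S' sx'} => //= w p IHp y /andP[yw wp] nty.
    have ntw : ~~ connect (within e [set~ s]) t w.
      apply: contra nty => /connect_trans; apply.
      by rewrite connect_within_sym //; apply: connect1.
    rewrite IHp // andbT; case/andP: yw => _ yw.
    by rewrite /within /= yw andbT !inE; apply/andP; split;
      [apply: contraNneq nty => ->|apply: contraNneq ntw => ->].
  exists s; first by rewrite inE connect_within_sym //.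
  rewrite inE; apply/negP => /connectP[p x'p sE]; move: x'p.
  elim/last_ind: p sE => [|p w _]; first by move=> sE; rewrite sE x'S' in sS'.
  rewrite last_rcons rcons_path => <- /andP[_ /andP[/andP[_]]].
  by rewrite !inE eqxx.
have /card_gt0P[t0 _] := treeT.1.
have [S SF tS] := out t0; have [x] := iF _ _ SF SF; rewrite inE => /andP[xS _].
exact: key SF tS xS (ltnSn _).
Qed.

End Trees.

Section Bramble.
Variables (G : sgraph).

Definition touch (A B : {set G}) : Prop :=
  exists u v, [/\ u \in A, v \in B & (u == v) || adj u v].

(** The nodes whose bags contain a given vertex are connected, and successive vertices of a path in
    [A] share a bag, which glues these node sets together. *)
Lemma connected_bags (T : sgraph) (B : T -> {set G}) (A : {set G}) :
    tree_decomposition B -> connected_in (@adj G) A ->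
  connected_in (@adj T) [set t | ~~ [disjoint A & B t]].
Proof.
case=> _ _ eB vB cA s t; rewrite !inE => /pred0Pn[u /andP[/= uA us]].
case/pred0Pn=> v /andP[/= vA vt].
have same w a b : w \in A -> w \in B a -> w \in B b ->
    connect (within (@adj T) [set t | ~~ [disjoint A & B t]]) a b.
  move=> wA wa wb; apply: connect_sub (vB w a b wa wb) => x y.
  case/andP=> /andP[]; rewrite !inE => wx wy xy; apply: connect1.
  rewrite /within /= !inE xy andbT.
  by apply/andP; split; apply/pred0Pn; exists w; rewrite /= wA.
case/connectP: (cA _ _ uA vA) => p up vE; rewrite {}vE in vA vt.
elim: p u s up uA us vt {vA} => [|w p IH] u s /= up uA us vt.
  exact: same uA us vt.
case/andP: up => /andP[/andP[_ wA] uw] wp.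
have [x /andP[ux wx]] := eB _ _ uw.
exact: connect_trans (same u s x uA us ux) (IH w x wp wA wx vt).
Qed.

(** Touching sets give node sets with a common node, since an edge lies in some bag; the Helly
    property of subtrees then applies. *)
Lemma bramble_bag (F : {set {set G}}) (T : sgraph) (B : T -> {set G}) :
    tree_decomposition B ->
    {in F, forall A : {set G}, connected_in (@adj G) A} ->
    {in F &, forall A A' : {set G}, touch A A'} ->
  exists t, {in F, forall A : {set G}, ~~ [disjoint A & B t]}.
Proof.
move=> tB cF tF; have [treeT cov eB _] := tB.
have [|_ _ /imsetP[A AF ->] /imsetP[A' A'F ->]|t ht] :=
    @tree_helly T treeT [set [set t | ~~ [disjoint A & B t]] | A : {set G} in F].
- by move=> _ /imsetP[A AF ->]; apply: connected_bags => //; apply: cF.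
- have [u [v [uA vA' uv]]] := tF _ _ AF A'F.
  have [t /andP[ut vt]] : exists t, (u \in B t) && (v \in B t).
    case/orP: uv => [/eqP<-|]; last exact: eB.
    by have [t ut] := cov u; exists t; rewrite ut.
  exists t; rewrite !inE; apply/andP; split; apply/pred0Pn.
    by exists u; rewrite /= uA.
  by exists v; rewrite /= vA'.
- exists t => A AF.
  by have /ht := imset_f (fun A : {set G} => [set t | ~~ [disjoint A & B t]]) AF;
     rewrite inE.
Qed.

(** The easy half of the duality between treewidth and brambles: some bag meets every member of the
    bramble, so it has more than [w] vertices. *)
Lemma treewidth_ge (P : {set G} -> Prop) (w : nat) :
    (forall A, P A -> connected_in (@adj G) A) ->
    (forall A A', P A -> P A' -> touch A A') ->
    (forall X : {set G}, (#|X| <= w)%N -> exists2 A, P A & [disjoint A & X]) ->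
  (w <= treewidth G)%N.
Proof.
move=> cP tP hP; rewrite /treewidth; case: ex_minnP => _ /asboolP[T [B [tB <-]]] _.
have [t ht] : exists t, {in [set A | `[< P A >]], forall A : {set G}, ~~ [disjoint A & B t]}.
  apply: bramble_bag => // [A|A A']; rewrite !inE; first by move=> /asboolP/cP.
  by move=> /asboolP PA /asboolP PA'; apply: tP.
have wt : (w < #|B t|)%N.
  rewrite ltnNge; apply/negP => /hP[A PA dA].
  by have := ht A; rewrite inE dA => /(_ (asboolT PA)).
have := leq_trans wt (leq_bigmax (F := fun t => #|B t|) t).
by rewrite /width; case: (\max_(_ | _) _).
Qed.

End Bramble.

(** * Isolating vertices *)

Section Restriction.
Variable G : sgraph.
Implicit Types (S : {set G}) (v : G).

Lemma within_irrefl S : irreflexive (within (@adj G) S).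
Proof. by move=> x; rewrite /within /= adj_irrefl andbF. Qed.

(* All vertices are kept, those outside S becoming isolated. *)
Definition restrict S : sgraph :=
  SGraph (within_sym (@adj_sym G) S) (within_irrefl S).

Lemma treewidth_le w : has_width G w -> treewidth G <= w.
Proof.
by rewrite /treewidth => hw; case: ex_minnP => m _; apply; exact/asboolP.
Qed.

Lemma treewidth_has_width : has_width G (treewidth G).
Proof. by rewrite /treewidth; case: ex_minnP => m /asboolP. Qed.

End Restriction.

Section Star.
Variables (G : sgraph) (c : G).

(** A tree on the vertices themselves, to index one singleton bag per vertex of an edgeless
    graph. *)
Definition star_adj : rel G := [rel x y | (x != y) && ((x == c) || (y == c))].

Lemma star_sym : symmetric star_adj.
Proof. by move=> x y; rewrite /star_adj /= eq_sym orbC. Qed.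

Lemma star_irrefl : irreflexive star_adj.
Proof. by move=> x; rewrite /star_adj /= eqxx. Qed.

Definition star : sgraph := SGraph star_sym star_irrefl.

(** Every edge contains the centre [c], whereas a cycle with at least three vertices has an edge
    avoiding any given vertex. *)
Lemma star_tree : is_tree star.
Proof.
split; first by apply/card_gt0P; exists c.
have to_c (x : star) : connect (@adj star) x c.
  have [->|xc] := eqVneq x c; first exact: connect0.
  by apply: connect1; rewrite /= /star_adj /= xc eqxx orbT.
split=> [s t|].
  apply: connect_trans (to_c s) _.
  by rewrite (sym_connect_sym (@adj_sym star)).
case=> [|x [|y [|z p]]] //; rewrite /ucycle [cycle _ _]/= rcons_path.
rewrite /star_adj /= !inE !negb_or -!andbA.
move=> /and5P[_ /orP exy _ /orP eyz /and5P[_ _ /orP elx xy /and5P[xz xp yz yp _]]].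
have [xc|xc] := eqVneq x c.
  by case: eyz => /eqP e; [rewrite xc e eqxx in xy|rewrite xc e eqxx in xz].
have [yc|yc] := eqVneq y c; last by case: exy => /eqP e; rewrite e eqxx in xc yc.
case: elx => /eqP e; last by rewrite e eqxx in xc.
have := mem_last z p; rewrite e -yc inE (negPf yz) /=.
by rewrite (negPf yp).
Qed.

End Star.

Lemma treewidth_edgeless (G : sgraph) (c : G) :
  (forall u v : G, ~~ adj u v) -> treewidth G = 0.
Proof.
move=> noE; apply/eqP; rewrite -leqn0; apply: treewidth_le.
exists (star c), (fun t => [set t]); split.
  split; first exact: star_tree.
  - by move=> v; exists v; rewrite inE.
  - by move=> u v uv; have := noE u v; rewrite uv.
  - by move=> v s t; rewrite !inE => /eqP<- /eqP<-.
rewrite /width; apply/eqP; rewrite -leqn0 -ltnS.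
have -> // : \max_(t : star c) #|[set t]| = 1.
apply/eqP; rewrite eqn_leq; apply/andP; split.
  by apply/bigmax_leqP => t _; rewrite cards1.
by rewrite -(cards1 (c : star c)); exact: (leq_bigmax (F := fun t : star c => #|[set t]|) c).
Qed.

Section ExactTreewidth.
Variable G : sgraph.
Implicit Types (S : {set G}) (v : G).

Lemma treewidth_restrictT : treewidth G <= treewidth (restrict [set: G]).
Proof.
have [T [B [[tT cov eB vB] <-]]] := treewidth_has_width (restrict [set: G]).
apply: treewidth_le; exists T, B; split=> //; split=> // u v uv.
by apply: eB; rewrite /= /within /= !inE.
Qed.

(** Adding [v] to every bag takes care of the edges at [v] and enlarges each bag by at most one. *)
Lemma treewidth_restrictD1 S v :
  treewidth (restrict S) <= (treewidth (restrict (S :\ v))).+1.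
Proof.
have [T [B [[tT cov eB vB] wB]]] := treewidth_has_width (restrict (S :\ v)).
pose B' (t : T) : {set G} := v |: B t.
apply: (@leq_trans (width (G := restrict S) B')).
  apply: treewidth_le; exists T, B'; split=> //; split=> //.
  - by move=> u; have [t ut] := cov u; exists t; rewrite inE ut orbT.
  - move=> a b /andP[/andP[aS bS] ab].
    have [av|av] := eqVneq a v.
      by have [t bt] := cov b; exists t; rewrite !inE av eqxx bt orbT.
    have [bv|bv] := eqVneq b v.
      by have [t at_] := cov a; exists t; rewrite !inE bv eqxx at_ orbT.
    have [|t /andP[at_ bt]] := eB a b; first by rewrite /= /within /= !inE av bv aS bS.
    by exists t; rewrite !inE at_ bt !orbT.
  - move=> u s t us ut; have [uv|uv] := eqVneq u v.
      have [_ [/(_ s t) conT _]] := tT.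
      by apply: connect_sub conT => x y xy; apply: connect1; rewrite /= !inE uv eqxx.
    move: us ut; rewrite !inE (negPf uv) /= => us ut.
    apply: connect_sub (vB u s t us ut) => x y /andP[/andP[]]; rewrite !inE => ux uy xy.
    by apply: connect1; rewrite /= !inE ux uy !orbT.
rewrite -wB /width.
have [t vt] := cov v.
(* As [width] truncates the predecessor at 0, the maximum must be positive to be recovered as a
   successor. *)
have pos : 0 < \max_(t : T) #|B t|.
  apply: leq_trans (leq_bigmax (F := fun t => #|B t|) t).
  by apply/card_gt0P; exists v.
rewrite prednK // -subn1 leq_subLR.
apply/bigmax_leqP => s _; rewrite cardsU1; apply: leq_add; first exact: leq_b1.
exact: (leq_bigmax (F := fun t => #|B t|) s).
Qed.

(** A discrete intermediate value argument: vertices outside [S0] are isolated while the treewidth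
    exceeds [w], and drops of at most one cannot skip [w]. *)
Lemma treewidth_between S0 w :
    treewidth (restrict S0) <= w <= treewidth G ->
  exists2 S : {set G}, S0 \subset S & treewidth (restrict S) = w.
Proof.
case/andP=> le0 /leq_trans/(_ treewidth_restrictT) leT.
have [n] := ubnP #|[set: G]|.
elim: n [set: G] leT (subsetT S0) => // n IH S leS S0S ltn.
have [eS|neS] := eqVneq (treewidth (restrict S)) w; first by exists S.
have /properP[_ [v vS vS0]] : S0 \proper S.
  rewrite properEneq S0S andbT; apply: contra_neq neS => eS.
  by apply/eqP; rewrite eqn_leq leS -eS le0.
apply: (IH (S :\ v)).
- by rewrite -ltnS; apply: leq_trans (treewidth_restrictD1 S v); rewrite ltn_neqAle eq_sym neS.
- apply/subsetP => u uS0; rewrite !inE (subsetP S0S) // andbT.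
  by apply: contraNneq vS0 => <-.
- by move: ltn; rewrite (cardsD1 v S) vS.
Qed.

(** Isolating the two vertices of the cover leaves no edge and lowers the treewidth by at most
    two. *)
Lemma treewidth_vertex_cover2 S (a b : G) :
    {in S &, forall u v, adj u v -> (u \in [set a; b]) || (v \in [set a; b])} ->
  treewidth (restrict S) <= 2.
Proof.
move=> cov; apply: leq_trans (treewidth_restrictD1 S a) _; rewrite ltnS.
apply: leq_trans (treewidth_restrictD1 _ b) _; rewrite ltnS.
rewrite leqn0 (@treewidth_edgeless (restrict _) a) // => u v.
rewrite /= /within /= !inE; apply/negP => /andP[/andP[]].
move=> /and3P[ub ua uS] /and3P[vb va vS] /(cov u v uS vS).
by rewrite !inE (negPf ua) (negPf ub) (negPf va) (negPf vb).
Qed.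

End ExactTreewidth.

(** * Chords of a circle *)

Lemma set2_eqP (T : finType) (a b c d : T) :
  [set a; b] = [set c; d] -> a = c /\ b = d \/ a = d /\ b = c.
Proof.
move=> e; have ha := set21 a b; have hb := set22 a b.
have hc := set21 c d; have hd := set22 c d.
rewrite e in ha hb; rewrite -e in hc hd.
by case/set2P: ha; case/set2P: hb; case/set2P: hc; case/set2P: hd; intros; subst; auto.
Qed.

Section Geometry.
Import Order.TTheory GRing.Theory Num.Theory.
Local Open Scope ring_scope.
Variable R : realType.
Implicit Types (A B C D c : 'rV[R]_2) (r s t : R).

(** Twice the signed area of the triangle [ABC]; its sign tells on which side of the line [AB] the
    point [C] lies. *)
Definition orient A B C : R :=
  (B 0 0 - A 0 0) * (C 0 1 - A 0 1) - (B 0 1 - A 0 1) * (C 0 0 - A 0 0).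

Definition dist2 A B : R := (B 0 0 - A 0 0) ^+ 2 + (B 0 1 - A 0 1) ^+ 2.

Definition scal A B C : R :=
  (B 0 0 - A 0 0) * (C 0 0 - A 0 0) + (B 0 1 - A 0 1) * (C 0 1 - A 0 1).

Lemma rV2_eq A B : A 0 0 = B 0 0 -> A 0 1 = B 0 1 -> A = B.
Proof.
move=> e0 e1; apply/rowP => -[[|[|//]] i].
  by rewrite (_ : Ordinal i = 0) //; apply: val_inj.
by rewrite (_ : Ordinal i = 1) //; apply: val_inj.
Qed.

Lemma dist2_gt0 A B : A != B -> 0 < dist2 A B.
Proof.
move=> AB; rewrite lt_neqAle addr_ge0 ?sqr_ge0 // andbT eq_sym.
rewrite paddr_eq0 ?sqr_ge0 // !sqrf_eq0 !subr_eq0.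
by apply: contra AB => /andP[/eqP e0 /eqP e1]; apply/eqP/rV2_eq.
Qed.

Lemma orient_line A B C :
  A != B -> orient A B C = 0 -> exists s, C = (1 - s) *: A + s *: B.
Proof.
move=> /dist2_gt0 N o0; have N0 : dist2 A B != 0 by rewrite gt_eqF.
(* The parameter of the orthogonal projection of [C] on the line [AB]; the coordinates of the
   residue are multiples of [orient A B C]. *)
exists (scal A B C / dist2 A B).
apply: rV2_eq; rewrite !mxE; apply/eqP; rewrite -subr_eq0.
  have -> : C 0 0 - ((1 - scal A B C / dist2 A B) * A 0 0 +
      scal A B C / dist2 A B * B 0 0) =
      - (B 0 1 - A 0 1) * orient A B C / dist2 A B.
    by move: N0; rewrite /scal /orient /dist2 => N0; field.
  by rewrite o0 mulr0 mul0r.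
have -> : C 0 1 - ((1 - scal A B C / dist2 A B) * A 0 1 +
    scal A B C / dist2 A B * B 0 1) =
    (B 0 0 - A 0 0) * orient A B C / dist2 A B.
  by move: N0; rewrite /scal /orient /dist2 => N0; field.
by rewrite o0 mulr0 mul0r.
Qed.

(* The power of a point of the line AB with respect to the circle. *)
Lemma chord_power c r A B s : on_circle c r A -> on_circle c r B ->
  dist2 c ((1 - s) *: A + s *: B) = r ^+ 2 - s * (1 - s) * dist2 A B.
Proof.
rewrite /on_circle /dist2 !mxE => hA hB.
have -> : r ^+ 2 = (1 - s) * r ^+ 2 + s * r ^+ 2 by ring.
by rewrite -{1}hA -hB; ring.
Qed.

(** A line meets a circle at most twice: a collinear [C] would have power zero, forcing its
    parameter on [AB] to be 0 or 1. *)
Lemma orient_neq0 c r A B C :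
    on_circle c r A -> on_circle c r B -> on_circle c r C ->
    A != B -> A != C -> B != C ->
  orient A B C != 0.
Proof.
move=> hA hB hC AB AC BC; apply/eqP => /(orient_line AB)[s CE].
have := chord_power s hA hB; rewrite -CE /dist2 hC => /eqP.
rewrite -subr_eq0 opprD addrA subrr add0r opprK -/(dist2 A B).
rewrite !mulf_eq0 (gt_eqF (dist2_gt0 AB)) orbF subr_eq0 => /orP[] /eqP e.
  by move: CE AC; rewrite e subr0 scale1r scale0r addr0 => ->; rewrite eqxx.
by move: CE BC; rewrite -e subrr scale1r scale0r add0r => ->; rewrite eqxx.
Qed.

Lemma orient_affine A B C D t :
  orient A B ((1 - t) *: C + t *: D) = (1 - t) * orient A B C + t * orient A B D.
Proof. by rewrite /orient !mxE; ring. Qed.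

Lemma orient_on_line A B s : orient A B ((1 - s) *: A + s *: B) = 0.
Proof. by rewrite /orient !mxE; ring. Qed.

(** The segment [CD] crosses the line [AB]; the crossing point is interior to the chord [CD], so its
    power is negative, which places it between [A] and [B] as well. *)
Lemma chords_meet c r A B C D :
    on_circle c r A -> on_circle c r B -> on_circle c r C -> on_circle c r D ->
    orient A B C < 0 < orient A B D ->
  exists s t, [/\ 0 < s < 1, 0 < t < 1 &
    (1 - s) *: A + s *: B = (1 - t) *: C + t *: D].
Proof.
move=> hA hB hC hD /andP[oC oD].
have AB : A != B.
  by apply: contraTneq oD => ->; rewrite /orient !subrr !mul0r subrr ltxx.
have CD : C != D by apply: contraTneq oC => ->; rewrite -leNgt ltW.
(* The zero of the affine function [orient A B] along [CD]. *)
pose t := - orient A B C / (orient A B D - orient A B C).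
have d0 : 0 < orient A B D - orient A B C by lra.
have t01 : 0 < t < 1.
  by rewrite /t divr_gt0 ?oppr_gt0 //= ltr_pdivrMr // mul1r; lra.
have [|s zE] := @orient_line A B ((1 - t) *: C + t *: D) AB.
  rewrite orient_affine /t.
  by field; rewrite gt_eqF.
exists s, t; split=> //.
have : s * (1 - s) * dist2 A B = t * (1 - t) * dist2 C D.
  have := chord_power s hA hB; rewrite -zE (chord_power t hC hD); lra.
have : 0 < t * (1 - t) * dist2 C D.
  case/andP: t01 => t0 t1; apply: mulr_gt0; last exact: dist2_gt0.
  by apply: mulr_gt0; rewrite ?subr_gt0.
move=> + e; rewrite -e pmulr_lgt0 ?dist2_gt0 // => ss; nra.
Qed.

End Geometry.

Section HubCrossings.
Import Order.TTheory GRing.Theory Num.Theory.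
Local Open Scope ring_scope.
Variables (R : realType) (G : sgraph) (p : G -> 'rV[R]_2).
Hypothesis drawing : convex_drawing p.

Lemma edgesP (u v : G) : adj u v -> [set u; v] \in edges G.
Proof. by move=> uv; apply/imset2P; exists u v; rewrite // inE. Qed.

(* All of U lies on one side of the line ab; the crossed edge joins a to the
   point w of U whose direction seen from a makes the smallest angle with ab, so
   that this edge separates b from the rest of U. *)
Lemma hub_crossings (a b : G) (U : {set G}) k :
    {in U, forall u, adj a u && adj b u} ->
    {in U, forall u, 0 < orient (p a) (p b) (p u)} -> (k < #|U|)%N ->
  exists2 f, f \in edges G &
    (k <= #|[set g in edges G | `[< crosses p f g >]]|)%N.
Proof.
case: drawing => inj [c [r [_ circ]]] hub pos kU.
have [w0 w0U] : exists w0, w0 \in U by apply/card_gt0P; apply: leq_ltn_trans kU.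
(* The cotangent of the angle at [a] between [ab] and [au]: maximal slope means smallest angle. *)
pose slope u := scal (p a) (p b) (p u) / orient (p a) (p b) (p u).
have [w wU wmax] := @arg_maxP _ R G w0 (mem U) slope w0U.
have {}wU : w \in U := wU.
have [aw bw] := andP (hub w wU).
have neq (x y : G) : adj x y -> x != y by apply: contraTneq => ->; rewrite adj_irrefl.
have pneq u v : u != v -> p u != p v by apply: contra_neq => /inj.
have ab : p a != p b.
  by apply: contraTneq (pos w wU) => ->; rewrite /orient !subrr !mul0r subrr ltxx.
exists [set a; w]; first exact: edgesP.
rewrite (cardsD1 w) wU add1n ltnS in kU.
apply: leq_trans kU _; rewrite -(@card_in_imset _ _ (fun u => [set b; u])).
  apply: subset_leq_card; apply/subsetP => _ /imsetP[u + ->].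
  rewrite !inE => /andP[uw uU]; have [au bu] := andP (hub u uU).
  rewrite edgesP //=; apply/asboolP; split.
    by apply/eqP => /set2_eqP[[e]|[_ e]];
      [rewrite e eqxx in ab|have := neq _ _ bw; rewrite e eqxx].
  have [|s [t [s01 t01 zE]]] := chords_meet (circ a) (circ w) (circ b) (circ u).
    have ou := pos u uU; have ow := pos w wU.
    apply/andP; split; first by move: ow; rewrite /orient; lra.
    have wu : w != u by rewrite eq_sym.
    rewrite lt_neqAle eq_sym (orient_neq0 (circ a) (circ w) (circ u)) ?pneq
      ?(neq _ _ aw) ?(neq _ _ au) //=.
    rewrite -(pmulr_rge0 _ (dist2_gt0 ab)).
    (* This identity turns the comparison of the slopes of [u] and [w] into the side of the line
       [aw] on which [u] lies. *)
    have -> : dist2 (p a) (p b) * orient (p a) (p w) (p u) =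
        scal (p a) (p b) (p w) * orient (p a) (p b) (p u)
        - scal (p a) (p b) (p u) * orient (p a) (p b) (p w).
      by rewrite /dist2 /orient /scal; ring.
    rewrite subr_ge0 -ler_pdivrMr // mulrAC -ler_pdivlMr //.
    exact: wmax.
  exists ((1 - s) *: p a + s *: p w); split.
    by exists a, w; split=> //; split; [exact: neq|exists s].
  by exists b, u; split=> //; split; [exact: neq|exists t].
move=> u v; rewrite !inE => /andP[_ uU] /andP[_ vU] /set2_eqP[[_ //]|[bv ub]].
by rewrite ub bv.
Qed.

End HubCrossings.

(** No vertex of [W] lies on the line [ab], so one side contains more than [k] of them; exchanging
    [a] and [b] exchanges the sides. *)
Lemma lcr_convex_ge (R : realType) (G : sgraph) (a b : G) (W : {set G}) k :
    a != b -> {in W, forall u, adj a u && adj b u} -> k.*2 < #|W| ->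
  k <= lcr_convex R G.
Proof.
move=> ab hub kW; rewrite /lcr_convex.
case: ex_minnP => m /asboolP[p [dp crm]] _.
suff [f fE] : exists2 f, f \in edges G & k <= #|[set g in edges G | `[< crosses p f g >]]|.
  by move/leq_trans; apply; exact: crm.
case: (dp) => inj [c [r [_ circ]]].
pose L := [set u in W | (0 < orient (p a) (p b) (p u))%R].
have [kL|kL] := ltnP k #|L|.
  apply: (@hub_crossings R G p dp a b L) => // u; rewrite !inE; first by case/andP => /hub.
  by case/andP.
apply: (@hub_crossings R G p dp b a (W :\: L)).
- by move=> u; rewrite inE => /andP[_ /hub]; rewrite andbC.
- move=> u; rewrite !inE => /andP[+ uW]; rewrite uW /= -Order.TotalTheory.leNgt => o.
  have [au bu] := andP (hub u uW).
  have neq (x y : G) : x != y -> p x != p y by apply: contra_neq => /inj.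
  have nadj (x y : G) : adj x y -> x != y by apply: contraTneq => ->; rewrite adj_irrefl.
  have := orient_neq0 (circ a) (circ b) (circ u) (neq _ _ ab)
    (neq _ _ (nadj _ _ au)) (neq _ _ (nadj _ _ bu)).
  move=> n0; have : (orient (p a) (p b) (p u) < 0)%R by rewrite Order.POrderTheory.lt_neqAle n0.
  by rewrite /orient; lra.
- have := cardsID L W; rewrite (setIidPr _); last by apply/subsetP => u; rewrite inE => /andP[].
  lia.
Qed.

(** * Drawings given by an order of the vertices along the circle *)

Section CircleDrawing.
Import Order.TTheory GRing.Theory Num.Theory.
Local Open Scope ring_scope.
Variable R : realType.

(** The rational parametrization of the unit circle by the tangent of the half angle; the order
    along the circle is that of the parameters. *)
Definition circle_point (s : R) : 'rV[R]_2 :=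
  \row_j (if j == 0 then (1 - s ^+ 2) / (1 + s ^+ 2) else s *+ 2 / (1 + s ^+ 2)).

Lemma circle_point_den (s : R) : 0 < 1 + s ^+ 2.
Proof. by rewrite ltr_pwDl // sqr_ge0. Qed.

(** Up to a positive factor this is a Vandermonde product, so sides of chords are read off the order
    of the parameters. *)
Lemma orient_circle_point (a b c : R) :
  orient (circle_point a) (circle_point b) (circle_point c) =
  4 * (b - a) * ((c - a) * (c - b)) / ((1 + a ^+ 2) * (1 + b ^+ 2) * (1 + c ^+ 2)).
Proof.
rewrite /orient !mxE /=.
by field; rewrite !gt_eqF ?circle_point_den.
Qed.

Lemma on_circle_point s : on_circle 0 1 (circle_point s).
Proof.
rewrite /on_circle !mxE /=; field.
by rewrite gt_eqF ?circle_point_den.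
Qed.

Lemma circle_point_inj : injective circle_point.
Proof.
move=> a b ab; apply/eqP; rewrite -subr_eq0; apply/eqP.
have e0 := congr1 (fun A : 'rV_2 => A 0 0) ab.
have e1 := congr1 (fun A : 'rV_2 => A 0 1) ab.
move: e0 e1; rewrite !mxE /= => e0 e1.
(* The half-angle formula: sine divided by one plus cosine recovers the parameter. *)
have h (s : R) : (s *+ 2 / (1 + s ^+ 2)) / (1 + (1 - s ^+ 2) / (1 + s ^+ 2)) = s.
  by have := circle_point_den s => ?; field; apply/andP; split; apply: lt0r_neq0; lra.
by rewrite -(h a) e0 e1 h subrr.
Qed.

Variables (G : sgraph) (rho : G -> nat).
Hypothesis rho_inj : injective rho.

Definition rank_drawing (v : G) : 'rV[R]_2 := circle_point (rho v)%:R.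

Lemma rank_drawing_convex : convex_drawing rank_drawing.
Proof.
split; last by exists 0, 1; split=> // v; exact: on_circle_point.
move=> u v /circle_point_inj /eqP; rewrite eqr_nat => /eqP; exact: rho_inj.
Qed.

Lemma sub_mul_nat_lt0 (a b c : nat) :
  (c%:R - a%:R) * (c%:R - b%:R) < 0 :> R -> (minn a b < c < maxn a b)%N.
Proof.
apply: contraTT; rewrite negb_and -!leqNgt -leNgt leq_min geq_max.
by case/orP=> /andP[ca cb]; [rewrite mulr_le0 // subr_le0 ler_nat|
  rewrite mulr_ge0 // subr_ge0 ler_nat].
Qed.

Lemma sub_mul_nat_gt0 (a b c : nat) :
  0 < (c%:R - a%:R) * (c%:R - b%:R) :> R -> (c < minn a b)%N || (maxn a b < c)%N.
Proof.
apply: contraTT; rewrite negb_or -!leqNgt -leNgt geq_min leq_max.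
case/andP=> /orP[ca|cb] /orP[ca'|cb'].
- by rewrite (_ : c = a) ?subrr ?mul0r //; apply/eqP; rewrite eqn_leq ca ca'.
- by rewrite mulr_ge0_le0 // ?subr_ge0 ?subr_le0 ler_nat.
- by rewrite mulr_le0_ge0 // ?subr_ge0 ?subr_le0 ler_nat.
- by rewrite (_ : c = b) ?subrr ?mulr0 //; apply/eqP; rewrite eqn_leq cb cb'.
Qed.

(** The affine function [orient] of the chord [uv] vanishes at the crossing point, so it has
    opposite signs at the ends of [g], or is zero at both; in the latter case [g] would be
    [[set u; v]]. *)
Lemma rank_drawing_crosses (u v : G) (g : {set G}) :
    crosses rank_drawing [set u; v] g ->
  exists x y, [/\ g = [set x; y],
    (minn (rho u) (rho v) < rho x < maxn (rho u) (rho v))%N &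
    (rho y < minn (rho u) (rho v))%N || (maxn (rho u) (rho v) < rho y)%N].
Proof.
case=> ng [z [[u' [v' [fE [uv' [s [_ zf]]]]]] [x [y [gE [xy [t [t01 zg]]]]]]]].
pose al w : R := ((rho w)%:R - (rho u)%:R) * ((rho w)%:R - (rho v)%:R).
pose den w : R := 1 + (rho w)%:R ^+ 2.
have den0 w : 0 < den w by exact: circle_point_den.
have rinj w w' : (rho w)%:R = (rho w')%:R :> R -> w = w'.
  by move/eqP; rewrite eqr_nat => /eqP/rho_inj.
have uv : u != v.
  by case: (set2_eqP fE) => -[-> ->]; rewrite // eq_sym.
have oz : orient (rank_drawing u) (rank_drawing v) z = 0.
  rewrite zf; case: (set2_eqP fE) => -[-> ->]; first exact: orient_on_line.
  by rewrite /orient !mxE; ring.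
have al0 : (1 - t) * (al x / den x) + t * (al y / den y) = 0.
  have K0 : 4 * ((rho v)%:R - (rho u)%:R) / (den u * den v) != 0 :> R.
    apply: mulf_neq0; last by rewrite invr_eq0 mulf_neq0 // lt0r_neq0.
    apply: mulf_neq0; first by rewrite pnatr_eq0.
    by rewrite subr_eq0; apply: contra uv => /eqP/rinj ->.
  apply: (mulfI K0); rewrite mulr0 -oz zg orient_affine !orient_circle_point /al /den.
  by field; rewrite !gt_eqF ?circle_point_den.
have alE0 w : al w = 0 -> w \in [set u; v].
  by move/eqP; rewrite mulf_eq0 !subr_eq0 !inE => /orP[] /eqP/rinj ->; rewrite eqxx ?orbT.
case/andP: t01 => t0 t1.
have sgn w : Num.sg (al w / den w) = Num.sg (al w).
  by rewrite sgrM (gtr0_sg (x := (den w)^-1)) ?invr_gt0 ?mulr1.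
case: (ltgtP (al x) 0) => [ax|ax|ax].
- exists x, y; split=> //; first exact: sub_mul_nat_lt0.
  apply: sub_mul_nat_gt0; rewrite -/(al y) -sgr_gt0 -sgn sgr_gt0.
  have : al x / den x < 0 by rewrite pmulr_llt0 ?invr_gt0.
  nra.
- exists y, x; split; [by rewrite gE setUC| |exact: sub_mul_nat_gt0].
  apply: sub_mul_nat_lt0; rewrite -/(al y) -sgr_lt0 -sgn sgr_lt0.
  have : 0 < al x / den x by rewrite pmulr_lgt0 ?invr_gt0.
  nra.
- have ay : al y = 0.
    move: al0; rewrite ax mul0r mulr0 add0r => /eqP.
    rewrite mulf_eq0 (gt_eqF t0) /= mulf_eq0 invr_eq0 (gt_eqF (den0 y)) orbF.
    by move/eqP.
  case/eqP: ng; rewrite gE.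
  have := alE0 _ ax; have := alE0 _ ay; rewrite !inE.
  case/orP=> /eqP ey /orP[] /eqP ex; move: xy; rewrite ex ey ?eqxx // => _.
  by rewrite setUC.
Qed.

End CircleDrawing.

(** * A cylinder and a complete bipartite graph *)

Lemma chain_connected (T : finType) (e : rel T) (f : nat -> T) len :
    symmetric e -> (forall j, j.+1 < len -> e (f j) (f j.+1)) ->
  connected_in e [set f j | j : 'I_len].
Proof.
move=> e_sym; elim: len => [|len IH] fe.
  by move=> x y /imsetP[[]].
have -> : [set f j | j : 'I_len.+1] = [set f j | j : 'I_len] :|: [set f len].
  apply/setP => x; rewrite !inE; apply/imsetP/orP.
    case=> j _ ->; have := ltn_ord j; rewrite ltnS leq_eqVlt => /orP[/eqP->|jl].
      by right.
    by left; apply/imsetP; exists (Ordinal jl).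
  case=> [/imsetP[j _ ->]|/eqP->]; last by exists ord_max.
  by exists (widen_ord (leqnSn len) j).
case: len IH fe => [|len] IH fe.
  by move=> x y; rewrite !inE => /orP[/imsetP[[]]//|/eqP->] /orP[/imsetP[[]]//|/eqP->].
apply: (connected_inU e_sym _ (@connected_in1 _ e (f len.+1)) (x := f len) (y := f len.+1)).
- by apply: IH => j jl; apply: fe; apply: leq_trans jl _.
- by apply/imsetP; exists ord_max.
- by rewrite inE.
- by rewrite fe ?orbT.
Qed.

Lemma connected_in_bigcup (T I : finType) (e : rel T) (A : {set T})
    (K : I -> {set T}) (C : {set I}) :
    symmetric e -> connected_in e A ->
    {in C, forall c, connected_in e (K c)} ->
    {in C, forall c, exists x, x \in A :&: K c} ->
  connected_in e (A :|: \bigcup_(c in C) K c).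
Proof.
move=> e_sym cA cK mK; rewrite -big_enum /=.
have: {subset enum C <= C} by move=> c; rewrite mem_enum.
elim: (enum C) => [|c s IH] sC; first by rewrite big_nil setU0.
have cC : c \in C by apply: sC; rewrite inE eqxx.
rewrite big_cons setUCA setUC.
have [x] := mK c cC; rewrite inE => /andP[xA xK].
apply: (connected_inU e_sym _ (cK c cC) (x := x) (y := x)); rewrite ?eqxx ?inE ?xA //.
by apply: IH => d ds; apply: sC; rewrite inE ds orbT.
Qed.

Section Host.
Variable q : nat.

(** Since [h = k + 4], discarding [k + 3] of the [m] columns leaves [h + 2], and any [h] columns
    meet any [h + 2] columns because [h + (h + 2) > m]. *)
Let h := q.+2.*2.
Let m := h.*2.+1.
Let k := q.*2.
Let hE : h = q.+2.*2 := erefl.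
Let mE : m = h.*2.+1 := erefl.
Let kE : k = q.*2 := erefl.

Definition cyl_adj : rel ('I_m * 'I_q.+1) := [rel u v : 'I_m * 'I_q.+1 |
  [&& u.1 == v.1 & (u.2.+1 == v.2 :> nat) || (v.2.+1 == u.2 :> nat)] ||
  [&& u.2 == v.2 & (ordS u.1 == v.1) || (ordS v.1 == u.1)]].

(* The hubs are the two vertices with second component 0; that of the others
   plays no role in the adjacency, and the boolean tells on which side of the
   two hubs a vertex is drawn. *)
Definition bip_adj : rel (bool * 'I_k.+2) :=
  [rel u v : bool * 'I_k.+2 | (u.2 == ord0) (+) (v.2 == ord0)].

Definition host_adj : rel ('I_m * 'I_q.+1 + bool * 'I_k.+2) := fun u v =>
  match u, v with
  | inl u, inl v => cyl_adj u v
  | inr u, inr v => bip_adj u v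
  | _, _ => false
  end.

Lemma host_sym : symmetric host_adj.
Proof.
move=> [u|u] [v|v] //=; last by rewrite /bip_adj /= addbC.
rewrite /cyl_adj /= (eq_sym u.1 v.1) (eq_sym u.2 v.2).
by rewrite (orbC (u.2.+1 == _)) (orbC (ordS u.1 == _)).
Qed.

Lemma host_irrefl : irreflexive host_adj.
Proof.
move=> [[c i]|u] /=; last by rewrite /bip_adj /= addbb.
rewrite /cyl_adj /= !eqxx /= !orbb !eqn_leq ltnn /=; apply/eqP => /(congr1 val) /= e.
have := ltn_ord c; rewrite leq_eqVlt => /orP[/eqP cm|lt]; move: e.
  by rewrite cm modnn => c0; move: cm; rewrite -c0 /m /h.
by rewrite modn_small // => /eqP; rewrite eqn_leq ltnn.
Qed.

Definition host : sgraph := SGraph host_sym host_irrefl.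

(** The column index is read modulo [m], so that arcs may wrap around the cylinder. *)
Definition cell (j : nat) (i : 'I_q.+1) : host := inl (inZp j : 'I_m, i).

Lemma cell_val (c : 'I_m) i : inl (c, i) = cell c i :> host.
Proof. by rewrite /cell valZpK. Qed.

Lemma cell_modD j i : cell (j + m) i = cell j i.
Proof. by congr (inl (_, _)); apply: val_inj; rewrite /= modnDr. Qed.

Lemma inZp_shift_inj s j j' : j < m -> j' < m ->
  inZp (s + j) = inZp (s + j') :> 'I_m -> j = j'.
Proof.
move=> jm jm' /(congr1 val) /= /eqP; rewrite eqn_modDl !modn_small //.
by move/eqP.
Qed.

Lemma adj_cellS j i : @adj host (cell j i) (cell j.+1 i).
Proof.
rewrite /= /cyl_adj /= eqxx /=; apply/orP; right; apply/orP; left; apply/eqP.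
by apply: val_inj; rewrite /= -addn1 modnDml addn1.
Qed.

Definition arc s len i : {set host} := [set cell (s + j) i | j : 'I_len].

Lemma arc_connected s len i : connected_in (@adj host) (arc s len i).
Proof.
apply: (@chain_connected _ _ (fun j => cell (s + j) i)); first exact: adj_sym.
by move=> j _; rewrite addnS; exact: adj_cellS.
Qed.

Definition column (c : 'I_m) : {set host} := [set inl (c, i) | i : 'I_q.+1].

Lemma column_connected c : connected_in (@adj host) (column c).
Proof.
have -> : column c = [set cell c (inord j) | j : 'I_q.+1].
  by apply/setP => x; apply/imsetP/imsetP => -[i _ ->]; exists i;
    rewrite ?inord_val ?cell_val.
apply: (@chain_connected _ _ (fun j => cell c (inord j))); first exact: adj_sym.
move=> j jq; rewrite /= /cyl_adj /= eqxx /= !inordK ?eqxx //.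
exact: ltnW.
Qed.

(** As [h.*2 = m - 1], this arc starting just after [x] is the row [i] punctured at column [x]. *)
Definition cross i (x : 'I_m) (C : {set 'I_m}) : {set host} :=
  arc x.+1 h.*2 i :|: \bigcup_(c in C) column c.

Lemma mem_punctured_row i (x c : 'I_m) : c != x -> inl (c, i) \in arc x.+1 h.*2 i.
Proof.
move=> cx; rewrite cell_val; apply/imsetP.
have xm := ltn_ord x; have cm := ltn_ord c.
have [xc|xc] := ltnP x c.
  have lt : c - x.+1 < h.*2 by lia.
  by exists (Ordinal lt); rewrite //= subnKC.
have {}cx : c != x :> nat by [].
have lt : c + m - x.+1 < h.*2 by lia.
exists (Ordinal lt) => //=; rewrite subnKC ?cell_modD //.
by apply: leq_trans xm _; exact: leq_addl.
Qed.

Lemma cross_connected i x (C : {set 'I_m}) :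
  x \notin C -> connected_in (@adj host) (cross i x C).
Proof.
move=> xC; apply: connected_in_bigcup; first exact: adj_sym.
- exact: arc_connected.
- by move=> c _; exact: column_connected.
- move=> c cC; exists (inl (c, i)); rewrite inE mem_punctured_row //=.
    by apply/imsetP; exists i.
  by apply: contraNneq xC => <-.
Qed.

(** * A bramble in the cylinder *)

Inductive bramble : {set host} -> Prop :=
| bramble_arc (s : 'I_m) : bramble (arc s h ord0)
| bramble_cross i x (C : {set 'I_m}) :
    x \notin C -> h.+2 <= #|C| -> bramble (cross i x C).

Lemma touch_sym (G : sgraph) (A B : {set G}) : touch A B -> touch B A.
Proof.
by case=> u [v [uA vB uv]]; exists v, u; split=> //; rewrite eq_sym (@adj_sym G).
Qed.

Lemma mem_arc s len i j : j < len -> cell (s + j) i \in arc s len i.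
Proof. by move=> jl; apply/imsetP; exists (Ordinal jl). Qed.

(** Two disjoint arcs of length [h] leave out a single cell of the row of length [2h + 1], so they
    are adjacent at one of their ends. *)
Lemma touch_arcs (s t : 'I_m) : touch (arc s h ord0) (arc t h ord0).
Proof.
wlog st : s t / s <= t.
  by move=> H; case: (leqP s t) => [/H //|/ltnW /H]; exact: touch_sym.
have tm := ltn_ord t.
have h0 : 0 < h by rewrite /h.
have [d|d|d] := ltngtP (t - s) h.
- exists (cell (s + (t - s)) ord0), (cell (t + 0) ord0); split; [exact: mem_arc..|].
  by rewrite addn0 subnKC // eqxx.
- have [e|e] := eqVneq (t - s) h.+1.
    exists (cell (s + 0) ord0), (cell (t + h.-1) ord0).
    split; [by apply: mem_arc; lia|by apply: mem_arc; lia|].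
    have -> : cell (s + 0) ord0 = cell (t + h.-1).+1 ord0.
      by rewrite addn0 -cell_modD; congr cell; lia.
    by apply/orP; right; rewrite (@adj_sym host); exact: adj_cellS.
  exists (cell (s + 0) ord0), (cell (t + (s + m - t)) ord0).
  split; [by apply: mem_arc; lia|by apply: mem_arc; lia|].
  by rewrite addn0 subnKC ?cell_modD ?eqxx //; lia.
- exists (cell (s + h.-1) ord0), (cell (t + 0) ord0).
  split; [by apply: mem_arc; lia|by apply: mem_arc; lia|].
  have -> : cell (t + 0) ord0 = cell (s + h.-1).+1 ord0 by congr cell; lia.
  by apply/orP; right; exact: adj_cellS.
Qed.

(** The [h] columns visited by the arc cannot all avoid [C], and a full column contains the cell of
    the arc in it. *)
Lemma touch_arc_cross (s : 'I_m) i x (C : {set 'I_m}) :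
  h.+2 <= #|C| -> touch (arc s h ord0) (cross i x C).
Proof.
move=> hC; pose S : {set 'I_m} := [set inZp (s + j) | j : 'I_h].
have cS : #|S| = h.
  rewrite card_imset ?card_ord // => j j' /inZp_shift_inj e; apply: val_inj; apply: e.
    by apply: ltn_trans (ltn_ord j) _; lia.
  by apply: ltn_trans (ltn_ord j') _; lia.
have: ~~ [disjoint S & C].
  apply/negP => dSC; have := subset_leq_card (subsetT (S :|: C)).
  rewrite cardsU (disjoint_setI0 dSC) cards0 subn0 cS cardsT card_ord; lia.
case/pred0Pn=> _ /andP[/= /imsetP[j _ ->] cC].
exists (cell (s + j) ord0), (cell (s + j) ord0); split; last by rewrite eqxx.
  by apply/imsetP; exists j.
rewrite inE; apply/orP; right; apply/bigcupP; exists (inZp (s + j)) => //.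
by apply/imsetP; exists ord0.
Qed.

(** A column of [C] other than [x'] meets the punctured row of the second cross. *)
Lemma touch_crosses i x (C : {set 'I_m}) i' x' C' :
  h.+2 <= #|C| -> touch (cross i x C) (cross i' x' C').
Proof.
move=> hC; have [c] : exists c, c \in C :\ x'.
  apply/card_gt0P; rewrite lt0n; apply: contraTneq hC => e.
  by rewrite (cardsD1 x') e addn0 -ltnNge; case: (x' \in C).
rewrite !inE => /andP[cx' cC].
exists (inl (c, i')), (inl (c, i')); split; last by rewrite eqxx.
  rewrite inE; apply/orP; right; apply/bigcupP; exists c => //.
  by apply/imsetP; exists i'.
by rewrite inE mem_punctured_row.
Qed.

Lemma bramble_touch A A' : bramble A -> bramble A' -> touch A A'.
Proof.
case=> [s|i x C xC hC] [t|i' x' C' xC' hC'].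
- exact: touch_arcs.
- exact: touch_arc_cross.
- exact/touch_sym/touch_arc_cross.
- exact: touch_crosses.
Qed.

Lemma bramble_connected A : bramble A -> connected_in (@adj host) A.
Proof. by case=> *; [exact: arc_connected|exact: cross_connected]. Qed.

Definition hits (X : {set host}) (i : 'I_q.+1) : {set 'I_m} :=
  [set c | inl (c, i) \in X].

Lemma sum_hits (X : {set host}) : \sum_i #|hits X i| <= #|X|.
Proof.
rewrite -[#|X|]sum1_card big_sumType /=.
apply: leq_trans (leq_addr _ _).
rewrite (eq_bigr (fun i => \sum_c (inl (c, i) \in X : nat))) => [|i _]; last first.
  by rewrite -sum1_card big_mkcond /=; apply: eq_bigr => c _; rewrite inE; case: ifP.
rewrite exchange_big pair_big /=.
by rewrite [leqRHS]big_mkcond /=; apply: leq_sum => -[c i] _ /=; case: ifP.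
Qed.

(** Removing one hit [p] from row 0 leaves two consecutive arcs of length [h], and the at most one
    remaining hit cannot meet both. *)
Lemma bramble_avoid_arc (X : {set host}) :
  #|hits X ord0| <= 2 -> exists2 A, bramble A & [disjoint A & X].
Proof.
move=> h2.
have [D0|[p pD]] := set_0Vmem (hits X ord0).
  exists (arc (ord0 : 'I_m) h ord0); first exact: bramble_arc.
  apply/pred0P => x /=; apply/negP => /andP[/imsetP[j _ ->] jX].
  have : (inZp (0 + j) : 'I_m) \in hits X ord0 by rewrite inE.
  by rewrite D0 inE.
have [d1|] := boolP [disjoint arc (inZp p.+1 : 'I_m) h ord0 & X].
  by exists (arc (inZp p.+1 : 'I_m) h ord0) => //; exact: bramble_arc.
have [d2|] := boolP [disjoint arc (inZp (p + h).+1 : 'I_m) h ord0 & X].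
  by exists (arc (inZp (p + h).+1 : 'I_m) h ord0) => //; exact: bramble_arc.
case/pred0Pn=> _ /andP[/= /imsetP[j _ ->] jX].
case/pred0Pn=> _ /andP[/= /imsetP[j' _ ->] jX'].
have shift a b : cell ((inZp a : 'I_m) + b) ord0 = cell (a + b) ord0.
  by congr (inl (_, _)); apply: val_inj; rewrite /= modnDml.
rewrite shift in jX; rewrite shift in jX'.
have jm := ltn_ord j; have jm' := ltn_ord j'.
pose F (l : nat) : 'I_m := inZp (p + l).
have neqF a b : a < m -> b < m -> a != b -> F a != F b.
  by move=> am bm; apply: contra_neq; exact: inZp_shift_inj.
have : [set F 0; F (1 + j'); F (1 + h + j)] \subset hits X ord0.
  apply/subsetP => c; rewrite !inE -orbA => /or3P[] /eqP ->.
  - by rewrite /F addn0 valZpK; rewrite inE in pD.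
  - by rewrite /F addnA addn1.
  - by rewrite /F !addnA addn1.
move/subset_leq_card; rewrite -setUA !cardsU1 cards1 !inE.
rewrite !(negPf (neqF _ _ _ _ _)); try lia.
by move/leq_trans/(_ h2).
Qed.

(** The row is punctured at its only possible hit and completed by all columns that avoid both [X]
    and the puncture. *)
Lemma bramble_avoid_cross (X : {set host}) i :
    #|X| <= k.+2 -> #|hits X i| <= 1 ->
  exists2 A, bramble A & [disjoint A & X].
Proof.
move=> cX hi.
have [x xP] : exists x, hits X i \subset [set x].
  have [->|[x xD]] := set_0Vmem (hits X i); first by exists ord0; exact: sub0set.
  exists x; apply/subsetP => y yD; rewrite inE; apply: contraLR hi => yx.
  rewrite -ltnNge; apply: leq_trans (_ : #|[set x; y]| <= _).
    by rewrite cards2 eq_sym yx.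
  by apply/subset_leq_card/subsetP => z; rewrite !inE => /orP[] /eqP->;
    [rewrite inE in xD|rewrite inE in yD].
(* The columns met by [X]; vertices of [X] outside the cylinder are sent to [x], which [C] excludes
   in any case. *)
pose N : {set 'I_m} := [set if v is inl u then u.1 else x | v in X].
pose C := ~: (x |: N).
have hC : h.+2 <= #|C|.
  have hN : #|N| <= k.+2 := leq_trans (leq_imset_card _ _) cX.
  have hxN : #|x |: N| <= k.+3 by rewrite cardsU1; exact: leq_add (leq_b1 _) hN.
  have := cardsC (x |: N); rewrite card_ord => cC.
  rewrite -(leq_add2l #|x |: N|) cC.
  by apply: leq_trans (leq_add hxN (leqnn _)) _; lia.
have xC : x \notin C by rewrite !inE eqxx.
exists (cross i x C); first exact: bramble_cross.
apply/pred0P => v /=; apply/negP => /andP[/setUP[]].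
  case/imsetP=> j _ -> jX.
  have : (inZp (x.+1 + j) : 'I_m) \in [set x] by apply: (subsetP xP); rewrite inE.
  rewrite inE => /eqP e; have jl := ltn_ord j.
  have /inZp_shift_inj : inZp (x + j.+1) = inZp (x + 0) :> 'I_m.
    by rewrite addn0 valZpK addnS -addSn.
  have jm : j.+1 < m := jl.
  by move=> /(_ jm isT).
case/bigcupP=> c; rewrite !inE => /norP[_ cN] /imsetP[i' _ ->] cX'.
by case/negP: cN; apply/imsetP; exists (inl (c, i')).
Qed.

(** If neither kind of set avoids [X], then row 0 has at least 3 hits and each of the [q] other rows
    at least 2, which makes [k + 3] in all. *)
Lemma bramble_avoid (X : {set host}) :
  #|X| <= k.+2 -> exists2 A, bramble A & [disjoint A & X].
Proof.
move=> cX; have [h2|h3] := leqP #|hits X ord0| 2; first exact: bramble_avoid_arc.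
have [/existsP[i hi]|/existsPn no] := boolP [exists i, #|hits X i| <= 1].
  exact: bramble_avoid_cross cX hi.
have := sum_hits X; rewrite big_ord_recl.
have : \sum_(i < q) 2 <= \sum_(i < q) #|hits X (lift ord0 i)|.
  by apply: leq_sum => i _; have := no (lift ord0 i); rewrite -ltnNge.
rewrite sum_nat_const card_ord; move: cX; lia.
Qed.

Lemma host_treewidth_ge : k.+2 <= treewidth host.
Proof.
exact: treewidth_ge bramble_connected bramble_touch bramble_avoid.
Qed.

End Host.

(** * Crossings of the column by column drawing *)

Lemma ltn_lex n a b i j : i < n -> j < n ->
  (a * n + i < b * n + j) = (a < b) || (a == b) && (i < j).
Proof.
move=> il jl; case: (ltngtP a b) => [ab|ab|->] /=; last by rewrite ltn_add2l.
- apply: leq_trans (_ : a.+1 * n <= _); first by rewrite mulSn addnC ltn_add2r.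
  by apply: leq_trans (leq_addr _ _); rewrite leq_mul2r ab orbT.
- apply/negbTE; rewrite -leqNgt; apply: leq_trans (leq_addr i _).
  apply: leq_trans (_ : b.+1 * n <= _); last by rewrite leq_mul2r ab orbT.
  by rewrite mulSn addnC leq_add2r ltnW.
Qed.

Lemma eqn_lex n a b i j : i < n -> j < n ->
  a * n + i = b * n + j -> a = b /\ i = j.
Proof.
move=> il jl e; have := ltn_lex a b il jl; have := ltn_lex b a jl il.
rewrite e ltnn; lia.
Qed.

(* The chord joins row i of the columns c and d, which are consecutive in the
   first conclusion and the last and the first one in the second; there the
   roles of the two sides of the chord are exchanged. *)
Lemma lex_interleaved c d i a j a' j' :
    [|| (c < a) || (c == a) && (i < j) | (d < a) || (d == a) && (i < j)] &&
    [|| (a < c) || (a == c) && (j < i) | (a < d) || (a == d) && (j < i)] &&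
    (((a' < c) || (a' == c) && (j' < i)) && ((a' < d) || (a' == d) && (j' < i)) ||
     ((c < a') || (c == a') && (i < j')) && ((d < a') || (d == a') && (i < j'))) ->
  (d = c.+1 ->
    [&& (a == c) && (i < j) || (a == d) && (j < i),
        ~~ ((a' == c) && (i < j') || (a' == d) && (j' < i)),
        ~~ ((a' == c) && (j' == i)) & ~~ ((a' == d) && (j' == i))]) /\
  (d = 0 -> 0 < c -> a <= c -> a' <= c ->
    [&& (a' == c) && (i < j') || (a' == d) && (j' < i),
        ~~ ((a == c) && (i < j) || (a == d) && (j < i)),
        ~~ ((a == c) && (j == i)) & ~~ ((a == d) && (j == i))]).
Proof. by move=> H; split=> *; lia. Qed.

Section HostDrawing.
Variable q : nat.

Let h := q.+2.*2.
Let m := h.*2.+1.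
Let k := q.*2.
Let n := q.+1.
Let kE : k = q.*2 := erefl.

(** The bipartite part comes after the cylinder, in two blocks, each made of a hub followed by
    [k + 1] common neighbours; thus the hubs have [k + 1] of them on either side. *)
Definition rank (v : host q) : nat :=
  match v with
  | inl u => u.1 * n + u.2
  | inr u => m * n + (u.1 * k.+2 + u.2)
  end.

Lemma rank_inl_lt (u : 'I_m * 'I_n) : rank (inl u) < m * n.
Proof.
by rewrite -[m * n]addn0 /= ltn_lex ?ltn_ord.
Qed.

Lemma rank_inj : injective rank.
Proof.
move=> [u|u] [v|v].
- case: u v => c i [d j] /= /eqn_lex [||ecd eij]; rewrite ?ltn_ord //.
  by congr (inl (_, _)); apply: val_inj.
- by have := rank_inl_lt u => + e; rewrite e /= ltnNge leq_addr.
- by have := rank_inl_lt v => + e; rewrite -e /= ltnNge leq_addr.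
- case: u v => c i [d j] /= /addnI /eqn_lex [||ecd eij]; rewrite ?ltn_ord //.
  congr (inr (_, _)); last exact: val_inj.
  by case: c d ecd => -[].
Qed.

Definition separates (u v x y : host q) : bool :=
  (minn (rank u) (rank v) < rank x < maxn (rank u) (rank v)) &&
  ((rank y < minn (rank u) (rank v)) || (maxn (rank u) (rank v) < rank y)).

Lemma separatesC u v x y : separates u v x y = separates v u x y.
Proof. by rewrite /separates minnC maxnC. Qed.

(** Edges at the hub [b] share an endpoint with the given one. A crossing edge therefore starts at
    the other hub, and the order of the blocks forces it to end in block [b'], at one of the [k]
    common neighbours other than [l']. *)
Lemma bip_edge_crossings b b' l' : l' != ord0 ->
  exists2 L : {set {set host q}}, #|L| <= k &
    forall x y, adj x y -> separates (inr (b, ord0)) (inr (b', l')) x y ->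
    [set x; y] \in L.
Proof.
move=> l0.
pose hub : host q := inr (~~ b, ord0).
pose F (j : 'I_k.+2) : {set host q} := [set hub; inr (b', j)].
exists [set F j | j in ~: [set ord0; l']].
  apply: leq_trans (leq_imset_card _ _) _.
  rewrite -(leq_add2l #|[set ord0; l']|) cardsC cards2 [ord0 == _]eq_sym l0.
  by rewrite card_ord.
have pick d d' (j j' : 'I_k.+2) :
    (d == ~~ b) && (j == ord0) && (d' == b') && (j' != ord0) && (j' != l') ->
    [set inr (d, j); inr (d', j')] \in [set F j | j in ~: [set ord0; l']].
  move=> /andP[/andP[/andP[/andP[/eqP-> /eqP->] /eqP->] j0] jl].
  by apply/imsetP; exists j' => //; rewrite !inE negb_or j0.
case=> [u|[d j]] [v|[d' j']] //.
  move=> _; rewrite /separates => /andP[/andP[+ _] _].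
  rewrite gtn_min => /orP[] /(ltn_trans)/(_ (rank_inl_lt u));
    by rewrite /= ltnNge leq_addr.
move=> /= adjxy sep.
have {}sep : ((d == ~~ b) && (j == ord0) && (d' == b') && (j' != ord0) && (j' != l'))
  || ((d' == ~~ b) && (j' == ord0) && (d == b') && (j != ord0) && (j != l')).
  have lt1 := ltn_ord j; have lt2 := ltn_ord j'; have lt3 := ltn_ord l'.
  move: adjxy sep l0; rewrite /bip_adj /separates /= -!val_eqE /=.
  move: (nat_of_ord j) (nat_of_ord j') (nat_of_ord l') lt1 lt2 lt3 => nj nj' nl'.
  by clear pick F hub; case: b; case: b'; case: d; case: d' => /=; lia.
by case/orP: sep => /pick //; rewrite setUC.
Qed.

(** The two ends have consecutive ranks, so no vertex lies strictly between them. *)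
Lemma column_edge_crossings (u v x y : 'I_m * 'I_n) :
  u.1 = v.1 -> u.2.+1 = v.2 :> nat -> ~~ separates (inl u) (inl v) (inl x) (inl y).
Proof.
case: u v x y => [c i] [d j] [a l] [a' l'] /= -> ij; rewrite /separates /=.
rewrite -ij addnS; apply/negP => /andP[+ _].
by move: (d * n + i) (a * n + l) => r s; lia.
Qed.

(* The vertices strictly between (c, i) and (d, i) on the shorter arc of the
   circle, when d is the column following c. *)
Definition short_side (c d : 'I_m) (i : 'I_n) (w : 'I_m * 'I_n) : bool :=
  (w.1 == c) && (i < w.2) || (w.1 == d) && (w.2 < i).

(** Exactly one end of a crossing edge is on the short side: [x] in general, but [y] when the chord
    joins the last column to the first, since the ranks in between then form the long side. *)
Lemma row_edge_short_side (c d : 'I_m) i (x y : host q) :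
    d = c.+1 :> nat \/ c.+1 = m /\ d = 0 :> nat ->
    adj x y -> separates (inl (c, i)) (inl (d, i)) x y ->
  exists w z : 'I_m * 'I_n, [/\ [set x; y] = [set inl w; inl z] :> {set host q},
    cyl_adj w z, short_side c d i w, ~~ short_side c d i z &
    (z != (c, i)) && (z != (d, i))].
Proof.
move=> cd; case: x => [[a j]|u]; last first.
  move=> _; rewrite /separates => /andP[/andP[_ +] _].
  rewrite leq_max => /orP[] lt; have := ltn_trans lt (rank_inl_lt _);
    by rewrite /= ltnNge leq_addr.
case: y => [[a' j']|u] //= axy.
rewrite /separates /= => sep.
have li := ltn_ord i; have lj := ltn_ord j; have lj' := ltn_ord j'.
have lc := ltn_ord c; have la := ltn_ord a; have la' := ltn_ord a'.
move: sep; rewrite leq_max !gtn_min gtn_max leq_min !ltn_lex // => sep.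
have [succ wrap] := lex_interleaved sep.
case: cd => [/succ/and4P[? ? ? ?]|[cm d0]].
  by exists (a, j), (a', j'); split=> //; rewrite !xpair_eqE; apply/andP.
have c0 : 0 < c by case: (posnP c) cm => [->|//]; rewrite /m /h.
have [||? ? ? ?] := and4P (wrap d0 c0 _ _); try by rewrite -ltnS cm.
exists (a', j'), (a, j); split=> //; first exact: setUC.
  by have := host_sym (inl (a, j) : host q) (inl (a', j')); rewrite /= axy => <-.
by rewrite !xpair_eqE; apply/andP.
Qed.

(** The short side has one vertex in each row other than [i], and only its two row edges can cross
    the chord: the one between the columns [c] and [ordS c], encoded by [true], and the one leaving
    these columns, encoded by [false]. This gives [2 * q = k] edges. *)
Lemma row_edge_crossings c i :
  exists2 L : {set {set host q}}, #|L| <= k &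
    forall x y, adj x y -> separates (inl (c, i)) (inl (ordS c, i)) x y ->
    [set x; y] \in L.
Proof.
pose v (a : 'I_m) (j : 'I_n) : host q := inl (a, j).
pose F (t : 'I_n * bool) : {set host q} :=
  if t.2 then [set v c t.1; v (ordS c) t.1]
  else if i < t.1 then [set v (ord_pred c) t.1; v c t.1]
  else [set v (ordS c) t.1; v (ordS (ordS c)) t.1].
exists [set F t | t in setX [set~ i] [set: bool]].
  apply: leq_trans (leq_imset_card _ _) _.
  by rewrite cardsX cardsC1 card_ord cardsT card_bool muln2.
have cd : ordS c = c.+1 :> nat \/ c.+1 = m /\ ordS c = 0 :> nat.
  have := ltn_ord c; rewrite leq_eqVlt => /orP[/eqP cm|lt].
    by right; split=> //=; rewrite cm modnn.
  by left; rewrite /= modn_small.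
move=> x y axy /(row_edge_short_side cd axy)[[a j] [[a' j'] [-> awz sw sz zuv]]].
have FL (b : bool) : j != i -> F (j, b) \in [set F t | t in setX [set~ i] [set: bool]].
  by move=> ji; apply/imsetP; exists (j, b) => //; rewrite !inE ji.
have ji : j != i by apply: contraTneq sw => ->; rewrite /short_side /= ltnn !andbF.
case/orP: awz => /= /andP[/eqP e aj].
  (* A column edge from a vertex of the short side stays there or ends at an endpoint of the
     chord. *)
  exfalso; move: sw sz zuv aj; rewrite /short_side /= {}e !xpair_eqE /= -(val_eqE j' i) /=.
  move: (a' == c) (a' == ordS c) (nat_of_ord j) (nat_of_ord j') (nat_of_ord i).
  by move=> A D s t r; lia.
rewrite -{}e in sz zuv *.
case/orP: sw => /= /andP[/eqP aE ij]; subst a.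
  case/orP: aj => /eqP aj; first by rewrite -aj; exact: (FL true).
  have := FL false ji; rewrite /F /= ij -aj ordSK setUC; exact.
case/orP: aj => /eqP aj; last first.
  by have := FL true ji; rewrite (ordS_inj aj) setUC; exact.
by have := FL false ji; rewrite /F /= ltnNge (ltnW ij) /= -aj; exact.
Qed.

Lemma host_edge_crossings (u v : host q) : adj u v ->
  exists2 L : {set {set host q}}, #|L| <= k &
    forall x y, adj x y -> separates u v x y -> [set x; y] \in L.
Proof.
have swap (u' v' : host q) (L : {set {set host q}}) :
    (forall x y, adj x y -> separates u' v' x y -> [set x; y] \in L) ->
    forall x y, adj x y -> separates v' u' x y -> [set x; y] \in L.
  by move=> H x y; rewrite separatesC; exact: H.
case: u v => [[c i]|[b l]] [[d j]|[b' l']] //=; last first.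
  rewrite /bip_adj /=; have [->|l0] := eqVneq l ord0; first exact: bip_edge_crossings.
  rewrite addFb => /eqP ->.
  by have [L cL HL] := bip_edge_crossings b' b l0; exists L => //; exact: swap.
case/orP => /= /andP[/eqP <-].
  move=> ij; exists set0; first by rewrite cards0.
  have no x y : adj x y -> ~~ separates (inl (c, i)) (inl (c, j)) x y.
    move=> axy; apply/negP => sep.
    case: x y axy sep => [x|x] [y|y] //= axy sep.
      case/orP: ij => /eqP ij; last rewrite separatesC in sep;
        by move: sep; apply/negP; apply: column_edge_crossings.
    move: sep => /andP[/andP[_ +] _]; rewrite leq_max => /orP[] lt;
      by have := ltn_trans lt (rank_inl_lt _); rewrite /= ltnNge leq_addr.
  by move=> x y axy sep; have := no x y axy; rewrite sep.
case/orP=> /eqP <-; first exact: row_edge_crossings.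
by have [L cL HL] := row_edge_crossings d i; exists L => //; exact: swap.
Qed.

End HostDrawing.

(** Isolating vertices only removes edges, so the drawing of the whole graph also serves every
    restriction. *)
Lemma host_outer_kplanar (R : realType) q (S : {set host q}) :
  outer_kplanar R (restrict S) q.*2.
Proof.
pose rho (v : restrict S) := rank (v : host q).
exists (@rank_drawing R (restrict S) rho).
split; first by apply: rank_drawing_convex => u v; exact: rank_inj.
move=> f /imset2P[u v _]; rewrite inE => /andP[_ /andP[_ uv]] ->.
have [L cL HL] := host_edge_crossings uv.
apply: leq_trans cL; apply/subset_leq_card/subsetP => g.
rewrite inE => /andP[/imset2P[x' y' _]]; rewrite inE => /andP[_ /andP[_ xy']] gE /asboolP.
case/rank_drawing_crosses => [x1 x2|x [y [gE' bx by_]]]; first exact: rank_inj.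
have xy : @adj (host q) x y.
  have [|[<- <-]|[<- <-]] := @set2_eqP _ x' y' x y; first by rewrite -gE -gE'.
    exact: xy'.
  by rewrite adj_sym.
by rewrite gE'; apply: HL => //; rewrite /separates bx.
Qed.

Theorem theorem18 (R : realType) (k : nat) (hk : ~~ odd k) :
  exists G : sgraph, lcr_convex R G = k /\ treewidth G = (k + 2)%N.
Proof.
have -> : k = k./2.*2 by have := odd_double_half k; rewrite (negPf hk).
move: k./2 => q {k hk}; rewrite addn2.

pose S0 : {set host q} := [set v | if v is inr _ then true else false].
pose hub (b : bool) : host q := inr (b, ord0).
have tw0 : treewidth (restrict S0) <= 2.
  apply: (@treewidth_vertex_cover2 _ S0 (hub false) (hub true)) => -[u|[b l]] [v|[b' l']];
    rewrite !inE //= => _ _.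
  have hubE d : (inr (d, ord0) == hub false :> host q) || (inr (d, ord0) == hub true :> host q).
    by case: d; rewrite eqxx ?orbT.
  rewrite /bip_adj /=; have [->|_] := eqVneq l ord0; first by rewrite hubE.
  by rewrite addFb => /eqP ->; rewrite hubE orbT.
(* The set [S] keeps the whole bipartite part, which secures the crossings, while the treewidth is
   tuned on the cylinder. *)
have [|S S0S twS] := @treewidth_between (host q) S0 q.*2.+2.
  by rewrite host_treewidth_ge andbT; apply: leq_trans tw0 _.
exists (restrict S); split=> //; apply/eqP; rewrite eqn_leq; apply/andP; split.
  rewrite /lcr_convex; case: ex_minnP => r _; apply; apply/asboolP.
  exact: host_outer_kplanar.
pose spoke (t : bool * 'I_q.*2.+2) : host q := inr t.
(* These are [2 * (k + 1)] common neighbours of the hubs, more than the [2 * k] that force [k]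
   crossings. *)
pose W : {set host q} := [set spoke t | t in setX [set: bool] [set~ ord0]].
apply: (@lcr_convex_ge R (restrict S) (hub false) (hub true) W) => //.
  move=> _ /imsetP[[b l] + ->]; rewrite !inE /= => l0.
  by rewrite /= /within /= !(subsetP S0S) ?inE //= /bip_adj /= (negPf l0).
rewrite card_imset; last by move=> t t' [].
by rewrite cardsX cardsT card_bool cardsC1 card_ord mul2n ltn_double.
Qed.
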